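(* Let $R$ be a minimal noncommutative division ring. Then no noncentral element of $R$ is algebraic over the centre of $R$.
   Context: All rings are associative with $1$, and subrings contain the identity element. A ring $R$ is minimal noncommutative if it is not commutative but all its proper subrings and all its proper homomorphic images (quotients by nonzero two-sided ideals) are commutative. *)

(* Defs.v *)
From HB Require Import structures.
From mathcomp Require Import all_boot all_algebra.

Set Implicit Arguments.
Unset Strict Implicit.
Unset Printing Implicit Defensive.

Import GRing.Theory.
Local Open Scope ring_scope.

Definition commutative_ring (R : pzRingType) : Prop :=
  forall x y : R, x * y = y * x.

(* Subrings are the {pred R} closed under the ring operations, hence contain 1;
   classically these are all the subrings of R. *)
Definition proper_subring (R : pzRingType) (S : {pred R}) : Prop :=
  GRing.subring_closed S /\ (exists x : R, x \notin S).

(* S is a homomorphic image of R through f, that is S = R / ker f, and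
   it is proper when the two-sided ideal ker f is nonzero. The zero ring is
   allowed as an image. *)
Definition proper_homomorphic_image (R S : pzRingType) (f : {rmorphism R -> S})
    : Prop :=
  (forall s : S, exists x : R, f x = s) /\ (exists2 x : R, x != 0 & f x = 0).

Definition minimal_noncommutative (R : pzRingType) : Prop :=
  [/\ ~ commutative_ring R,
      forall S : {pred R}, proper_subring S ->
        {in S &, forall x y : R, x * y = y * x}
    & forall (S : pzRingType) (f : {rmorphism R -> S}),
        proper_homomorphic_image f -> commutative_ring S].

Definition division_ring (R : unitRingType) : Prop :=
  forall x : R, x != 0 -> x \is a GRing.unit.

Definition central (R : pzRingType) (x : R) : Prop :=
  forall y : R, x * y = y * x.

(* R is not commutative, but since the coefficients of p are central there is
   no ambiguity in the evaluation of p at x. *)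
Definition algebraic_over_center (R : nzRingType) (x : R) : Prop :=
  exists p : {poly R}, [/\ p != 0, forall i : nat, central p`_i & root p x].

(* Main.v *)
Require Import Defs.
From HB Require Import structures.
From mathcomp Require Import all_boot all_algebra finfield.
From mathcomp.classical Require Import boolp.

(* Let F be the centre of R and x a noncentral element algebraic over F. The
   centralizer L of x is a proper subring, hence commutative, and R has finite
   dimension over L because x is algebraic; L being commutative, R then has
   finite dimension over F. Fix an F-basis e of R containing 1, with structure
   constants c. If V is a subring of F and 0 <> t in V satisfies t c in V, then
   V + t (sum_i V e_i) is a noncommutative subring, so it is R, and V = F.
   If some nonzero y in F has 1/y outside Z[y], then, by an integrality
   argument, Z[y] can be enlarged to such a V still avoiding 1/y: contradiction.
   Otherwise F has positive characteristic and is integral over Z, so the c's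
   generate a finite V, for which t = 1 is allowed: R is finite, contradicting
   Wedderburn's theorem. *)

Set Implicit Arguments.
Unset Strict Implicit.
Unset Printing Implicit Defensive.

Import GRing.Theory.
Local Open Scope ring_scope.

(** * Linear algebra over commutants in a division ring *)

Section Commutant.

Variable R : unitRingType.
Hypothesis divR : division_ring R.

(** With [G] empty, [eq x] or everything, this is [R], the centralizer of [x] or the centre. *)
Definition commutant (G : R -> Prop) (y : R) := forall g, G g -> GRing.comm g y.

(** Gaussian elimination stays in the commutant, which is closed under ring operations and inverses.
    Shrinking the support [X] removes an unknown without changing the index type. *)
Lemma homogeneous_system (G : R -> Prop) (J : finType) (n : nat)
    (A : nat -> J -> R) (X : {set J}) :
  (forall i j, commutant G (A i j)) -> (n < #|X|)%N ->
  exists t : J -> R, [/\ forall j, commutant G (t j),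
    forall j, j \notin X -> t j = 0, exists j, t j != 0 &
    forall i, (i < n)%N -> \sum_j t j * A i j = 0].
Proof.
elim: n A X => [|n IHn] A X cA ltnX.
  have [j0 Xj0] := card_gt0P ltnX.
  exists (fun j => if j == j0 then 1 else 0); split=> //.
  - by move=> j g _; case: ifP => _; [apply: commr1 | apply: commr0].
  - by move=> j; case: eqP => // ->; rewrite Xj0.
  - by exists j0; rewrite eqxx oner_eq0.
have [/existsP[j0 /andP[Xj0 nzA]]|noA] :=
    boolP [exists j, (j \in X) && (A n j != 0)]; last first.
  have [t [Dt supp_t nz_t eq_t]] := IHn A X cA (ltnW ltnX).
  exists t; split=> // i; rewrite ltnS leq_eqVlt => /predU1P[->|/eq_t//].
  apply: big1 => j _; have [Xj|/supp_t->] := boolP (j \in X);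
    last by rewrite mul0r.
  by move/existsPn/(_ j): noA; rewrite Xj negbK => /eqP->; rewrite mulr0.
(* Equation [n] is solved for the unknown [j0], with value [c] below, and substituted into the
   others; row [n] of [B] is therefore zero. *)
pose B i j := A i j - A n j * (A n j0)^-1 * A i j0.
have cB i j : commutant G (B i j).
  move=> g Gg; apply: commrB; first exact: cA.
  by apply: commrM; [apply: commrM; [|apply: commrV]|]; apply: cA.
have ltnX' : (n < #|X :\ j0|)%N by move: ltnX; rewrite (cardsD1 j0) Xj0.
have [t [Dt supp_t [j1 nz_t] eq_t]] := IHn B _ cB ltnX'.
have tj0 : t j0 = 0 by apply: supp_t; rewrite !inE eqxx.
pose c := - \sum_(j | j != j0) t j * (A n j * (A n j0)^-1).
exists (fun j => if j == j0 then c else t j); split.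
- move=> j; case: ifP => // _ g Gg; apply: commrN; apply: commr_sum => k _.
  apply: commrM; first exact: Dt.
  by apply: commrM; [|apply: commrV]; apply: cA.
- move=> j X'j; case: eqP => [jj0|_]; first by rewrite jj0 Xj0 in X'j.
  by apply: supp_t; rewrite !inE (negPf X'j) andbF.
- exists j1.
  by have /negPf-> : j1 != j0 by apply: contraNneq nz_t => ->; rewrite tj0.
have sumE i : \sum_j (if j == j0 then c else t j) * A i j = \sum_j t j * B i j.
  rewrite [LHS](bigD1 j0)//= eqxx [RHS](bigD1 j0)//= tj0 mul0r add0r.
  rewrite mulNr mulr_suml addrC -sumrB; apply: eq_bigr => j /negPf->.
  by rewrite mulrBr !mulrA.
move=> i; rewrite sumE ltnS leq_eqVlt => /predU1P[->|/eq_t//].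
by apply: big1 => j _; rewrite /B divrK ?divR// subrr mulr0.
Qed.

(* Scale a nonzero vector of [W] to have an entry [1]; its commutator with an
   element of [G] has smaller support. *)
Lemma commutant_descent (G : R -> Prop) (J : finType) (W : (J -> R) -> Prop) :
  (forall a t, W t -> W (fun j => a * t j)) ->
  (forall g t, G g -> W t -> W (fun j => g * t j - t j * g)) ->
  forall t, W t -> (exists j, t j != 0) ->
  exists t', [/\ W t', exists j, t' j != 0 & forall j, commutant G (t' j)].
Proof.
move=> WZ Wcomm t; have [k le_k] := ubnP #|[set j | t j != 0]|.
elim: k => // k IHk in t le_k * => Wt [j0 nz_t].
pose u j := (t j0)^-1 * t j; have Wu : W u by apply: WZ.
have uj0 : u j0 = 1 by rewrite /u mulVr ?divR.
have [|/existsNP[j /existsNP[g /not_implyP[Gg /eqP ncomm]]]] :=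
    pselect (forall j, commutant G (u j)).
  by exists u; split=> //; exists j0; rewrite uj0 oner_eq0.
apply: (IHk (fun j => g * u j - u j * g)); last 2 first.
- exact: Wcomm.
- by exists j; rewrite subr_eq0.
move: le_k; rewrite ltnS; apply: leq_trans; apply/proper_card/properP; split.
  apply/subsetP => i; rewrite !inE; apply: contraNneq => ti0.
  by rewrite /u ti0 !(mulr0, mul0r) subrr.
by exists j0; rewrite !inE ?uj0 ?mulr1 ?mul1r ?subrr ?eqxx.
Qed.

Definition left_dependent (D : R -> Prop) (J : finType) (s : J -> R) :=
  exists t : J -> R, [/\ forall j, D (t j), exists j, t j != 0 &
    \sum_j t j * s j = 0].

(** Only the first [n] values of [e] count, so that a family can grow without changing type. *)
Definition left_span (D : R -> Prop) (n : nat) (e : nat -> R) (s : R) :=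
  exists2 a : nat -> R, forall i, D (a i) & s = \sum_(i < n) a i * e i.

Definition left_free (D : R -> Prop) (n : nat) (e : nat -> R) :=
  forall a : nat -> R, (forall i, D (a i)) -> \sum_(i < n) a i * e i = 0 ->
  forall i, (i < n)%N -> a i = 0.

(** Appending a vector outside the span keeps a family free, since nonzero coefficients have
    inverses in the commutant; by [depN] a free family has at most [N] vectors, so this stops. *)
Lemma extend_basis (G : R -> Prop) (N n : nat) (e : nat -> R) :
  (forall s : 'I_N.+1 -> R, left_dependent (commutant G) s) ->
  left_free (commutant G) n e ->
  exists m e', [/\ (n <= m)%N, forall i, (i < n)%N -> e' i = e i,
    left_free (commutant G) m e' & forall s, left_span (commutant G) m e' s].
Proof.
move=> depN; have [k le_k] := ubnP (N.+1 - n)%N.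
elim: k => // k IHk in n e le_k * => fr_e.
have [spe|/existsNP[s nspan]] := pselect (forall s, left_span (commutant G) n e s).
  by exists n, e.
have lt_nN : (n < N.+1)%N.
  rewrite ltnNge; apply/negP => leNn.
  have [t [Dt [j nz_t] sum_t]] := depN (fun j => e j).
  (* A relation between the first [N.+1] vectors, padded with zeros. *)
  pose a i := if (i < N.+1)%N then t (inord i) else 0.
  have Da i : commutant G (a i).
    by move=> g Gg; rewrite /a; case: ifP => _; [apply: Dt | apply: commr0].
  have sum_a : \sum_(i < n) a i * e i = 0.
    rewrite -[RHS]sum_t.
    under [RHS]eq_bigr => j0 _ do rewrite -{1}(inord_val j0).
    rewrite (big_ord_widen _ (fun i => t (inord i) * e i) leNn) [RHS]big_mkcond.
    by apply: eq_bigr => i _; rewrite /a; case: ifP; rewrite ?mul0r.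
  case/eqP: nz_t; have := fr_e a Da sum_a j (leq_trans (ltn_ord j) leNn).
  by rewrite /a ltn_ord inord_val.
pose e1 i := if (i < n)%N then e i else s.
have sum_e1 (a : nat -> R) : \sum_(i < n.+1) a i * e1 i =
    \sum_(i < n) a i * e i + a n * s.
  rewrite big_ord_recr /= /e1 ltnn; congr (_ + _).
  by apply: eq_bigr => i _; rewrite ltn_ord.
have fr_e1 : left_free (commutant G) n.+1 e1.
  move=> a Da; rewrite sum_e1 => sum_a.
  have an0 : a n = 0.
    apply/eqP/negPn/negP => nz_an; case: nspan.
    exists (fun i => - ((a n)^-1 * a i)) => [i g Gg|].
      by apply: commrN; apply: commrM; [apply: commrV|]; apply: Da.
    under eq_bigr => i _ do rewrite mulNr -mulrA.
    move/eqP: sum_a; rewrite sumrN -mulr_sumr addr_eq0 => /eqP->.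
    by rewrite mulrN opprK mulrA mulVr ?divR// mul1r.
  move: sum_a; rewrite an0 mul0r addr0 => /(fr_e _ Da) a0 i.
  by rewrite ltnS leq_eqVlt => /predU1P[->|/a0].
have [|m [e' [ltnm e'E fr_e' sp_e']]] := IHk n.+1 e1 _ fr_e1.
  by rewrite ltnS in le_k; apply: leq_trans le_k; rewrite ltn_sub2l.
exists m, e'; split=> // [|i ltin]; first exact: ltnW.
by rewrite e'E 1?ltnW// /e1 ltin.
Qed.

End Commutant.

(** * Finite dimension over the centralizer, then over the centre *)

Section Finiteness.

Variable R : unitRingType.
Hypothesis divR : division_ring R.

Lemma centralP (z : R) : central z <-> commutant (fun=> True) z.
Proof. by split=> cz => [g _|g]; [apply: commr_sym; apply: cz | apply/esym/cz]. Qed.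

(** Besides the wanted relation, [W] imposes its twists by all powers of [x], which makes it stable
    under commutators with [x], as the descent requires. Only [(size p).-1] of these equations are
    independent, one fewer than the unknowns. *)
Lemma algebraic_dependent (x : R) (p : {poly R}) :
  p != 0 -> (forall i, central p`_i) -> root p x ->
  forall s : 'I_(size p) -> R, left_dependent (commutant (eq x)) s.
Proof.
move=> nzp cp /rootP px0 s.
have szp : (size p).-1.+1 = size p by rewrite prednK// lt0n size_poly_eq0.
pose W (t : 'I_(size p) -> R) := forall i, \sum_j t j * (x ^+ i * s j) = 0.
have [||t [_ _ nz_t sum_t]] := @homogeneous_system R divR (fun=> False)
    'I_(size p) (size p).-1 (fun i j => x ^+ i * s j) [set: 'I_(size p)].
- by move=> i j g [].
- by rewrite cardsT card_ord szp.
(* The sums over [j] satisfy in [i] the linear recurrence given by [p], with invertible leading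
   coefficient, so the first equations imply the rest. *)
have Wt : W t.
  elim/ltn_ind => i IHi; have [/sum_t//|ledi] := ltnP i (size p).-1.
  pose Sg k := \sum_j t j * (x ^+ k * s j).
  have relSg k : \sum_(l < (size p).-1.+1) p`_l * Sg (k + l)%N = 0.
    rewrite szp; under eq_bigr => l _ do rewrite mulr_sumr.
    rewrite exchange_big big1// => j _ /=.
    transitivity (t j * x ^+ k * (p.[x] * s j)); last by rewrite px0 mul0r mulr0.
    rewrite horner_coef mulr_suml mulr_sumr; apply: eq_bigr => l _.
    rewrite exprD !mulrA (cp l (t j)) -(mulrA (t j) p`_l) (cp l (x ^+ k)).
    by rewrite !mulrA.
  have := relSg (i - (size p).-1)%N; rewrite big_ord_recr /= subnK//.
  rewrite -/(Sg i) big1 ?add0r => [lead0|l _]; last first.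
    by rewrite /Sg IHi ?mulr0// -{2}(subnK ledi) ltn_add2l.
  have nzp_lead : p`_(size p).-1 != 0 by rewrite lead_coef_eq0.
  by apply: (mulrI (divR nzp_lead)); rewrite mulr0.
have [||t1 [Wt1 nz_t1 ct1]] :=
    @commutant_descent R divR (eq x) _ W _ _ t Wt nz_t.
- move=> a t2 Wt2 i; under eq_bigr => j _ do rewrite -mulrA.
  by rewrite -mulr_sumr Wt2 mulr0.
- move=> _ t2 <- Wt2 i.
  under eq_bigr => j _ do rewrite mulrBl -!mulrA (mulrA x (x ^+ i)) -exprS.
  by rewrite sumrB -mulr_sumr !Wt2 mulr0 subrr.
exists t1; split=> //; rewrite -[RHS](Wt1 0).
by apply: eq_bigr => j _; rewrite mul1r.
Qed.

Hypothesis minR : minimal_noncommutative R.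

Lemma centralizer_commutative (x : R) :
  ~ central x -> forall y z, commutant (eq x) y -> commutant (eq x) z ->
  GRing.comm y z.
Proof.
move=> ncx y z cy cz; have [_ minS _] := minR.
pose S : {pred R} := [pred u | `[<commutant (eq x) u>]].
have inS u : (u \in S) = `[<commutant (eq x) u>] by [].
apply: (minS S); rewrite ?inS; do ?exact/asboolP; split.
  split=> [|u v|u v]; rewrite !inS.
  - by apply/asboolP => g _; apply: commr1.
  - move=> /asboolP cu /asboolP cv; apply/asboolP => g Gg.
    by apply: commrB; [apply: cu | apply: cv].
  - move=> /asboolP cu /asboolP cv; apply/asboolP => g Gg.
    by apply: commrM; [apply: cu | apply: cv].
have [u xu] : exists u, x * u <> u * x by apply/existsNP.
by exists u; rewrite inS; apply/asboolPn => /(_ _ erefl).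
Qed.

(** Imposing [W] for every [s] gives stability under all commutators, so the descent produces
    central coefficients. For [t] in the commutative [L], the coordinates of [s] move past [t]; it
    suffices to take [s] among the [m] basis vectors, each giving [m] equations over [L]. *)
Lemma finite_over_center (x : R) :
  ~ central x -> algebraic_over_center x ->
  exists N, forall s : 'I_N.+1 -> R, left_dependent (commutant (fun=> True)) s.
Proof.
move=> ncx [p [nzp cp px0]].
pose L := commutant (eq x).
have CL := centralizer_commutative ncx.
have depL (s : 'I_(size p).-1.+1 -> R) : left_dependent L s.
  have eqd : (size p).-1.+1 = size p by rewrite prednK// lt0n size_poly_eq0.
  by move: s; rewrite eqd; apply: algebraic_dependent.
have [|m [e [_ _ _ sp_e]]] := @extend_basis R divR _ _ 0 (fun=> 0) depL.
  by [].
have /choice[c cP] : forall s, exists a : nat -> R,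
    (forall i, L (a i)) /\ s = \sum_(i < m) a i * e i.
  by move=> s; have [a] := sp_e s; exists a.
have cL s i : L (c s i) by have [] := cP s.
have cE s : s = \sum_(i < m) c s i * e i by have [] := cP s.
exists (m * m)%N => u.
pose W (t : 'I_(m * m).+1 -> R) := forall s, \sum_i t i * (s * u i) = 0.
(* Equation [j * m + k] is the [e k] coordinate of the relation for [s = e j]. *)
have [||t [Lt _ nz_t sum_t]] := @homogeneous_system R divR (eq x)
    'I_(m * m).+1 (m * m) (fun k i => c (e (k %/ m)%N * u i) (k %% m)%N)
    [set: 'I_(m * m).+1].
- by move=> i j; apply: cL.
- by rewrite cardsT card_ord.
have sum_te j k : (j < m)%N -> (k < m)%N -> \sum_i t i * c (e j * u i) k = 0.
  move=> ltjm ltkm; have m_gt0 := leq_ltn_trans (leq0n _) ltjm.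
  have := sum_t (j * m + k)%N; rewrite divnMDl// divn_small// addn0 modnMDl.
  rewrite modn_small//; apply.
  by rewrite -(ltn_divLR _ _ m_gt0) divnMDl// divn_small// addn0.
have Wt : W t.
  move=> s; rewrite {1}(cE s).
  under eq_bigr => i _ do rewrite mulr_suml mulr_sumr.
  rewrite exchange_big big1// => j _ /=.
  under eq_bigr => i _ do rewrite -mulrA mulrA (CL _ _ (Lt i) (cL _ _)) -mulrA.
  rewrite -mulr_sumr [X in _ * X](_ : _ = 0) ?mulr0//.
  under eq_bigr => i _ do rewrite (cE (e j * u i)) mulr_sumr.
  rewrite exchange_big big1// => k _ /=.
  by under eq_bigr => i _ do rewrite mulrA; rewrite -mulr_suml sum_te ?mul0r.
have [||t1 [Wt1 nz_t1 ct1]] :=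
    @commutant_descent R divR (fun=> True) _ W _ _ t Wt nz_t.
- move=> a t2 Wt2 s; under eq_bigr => i _ do rewrite -mulrA.
  by rewrite -mulr_sumr Wt2 mulr0.
- move=> g t2 _ Wt2 s; under eq_bigr => i _ do rewrite mulrBl -!mulrA (mulrA g s).
  by rewrite sumrB -mulr_sumr !Wt2 mulr0 subrr.
exists t1; split=> //; rewrite -[RHS](Wt1 1).
by apply: eq_bigr => i _; rewrite mul1r.
Qed.

End Finiteness.

(** * Orders over subrings of the centre *)

(** The elements of this form are a subring, because [t] clears the denominators of the structure
    constants. Were it proper, the [t * e i] would commute, hence so would the [e i], which span [R]
    over the centre. *)
Lemma order_full (R : unitRingType) (divR : division_ring R)
    (minR : minimal_noncommutative R) (m : nat) (e : nat -> R)
    (c : R -> nat -> R) (V : R -> Prop) (t : R) :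
  (forall s i, central (c s i)) -> (forall s, s = \sum_(i < m) c s i * e i) ->
  (forall v, V v -> central v) -> V 1 -> (forall v w, V v -> V w -> V (v - w)) ->
  (forall v w, V v -> V w -> V (v * w)) -> V t -> t != 0 ->
  (forall i j k : 'I_m, V (t * c (e i * e j) k)) ->
  forall r, exists v (w : nat -> R), [/\ V v, forall i, V (w i) &
    r = v + t * \sum_(i < m) w i * e i].
Proof.
move=> cc cE cV V1 VB VM Vt nzt Vtc.
have V0 : V 0 by rewrite -(subrr 1); exact: VB.
have VD v w : V v -> V w -> V (v + w).
  move=> Vv Vw; have -> : v + w = v - (0 - w) by rewrite sub0r opprK.
  by apply: (VB) => //; apply: VB.
have Vsum (I : finType) (F : I -> R) : (forall i, V (F i)) -> V (\sum_i F i).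
  by move=> VF; apply: big_ind => // i _.
pose P r := exists v (w : nat -> R), [/\ V v, forall i, V (w i) &
    r = v + t * \sum_(i < m) w i * e i].
pose S : {pred R} := [pred r | `[<P r>]].
have inS r : (r \in S) = `[<P r>] by [].
have subS : GRing.subring_closed S.
  split=> [|x y|x y]; rewrite !inS.
  - apply/asboolP; exists 1, (fun=> 0); split=> //.
    by rewrite big1 ?mulr0 ?addr0// => i _; rewrite mul0r.
  - move=> /asboolP[v [w [Vv Vw ->]]] /asboolP[v' [w' [Vv' Vw' ->]]].
    apply/asboolP; exists (v - v'), (fun i => w i - w' i).
    split=> [|i|]; do ?exact: (VB).
    under [X in _ = _ + t * X]eq_bigr => i _ do rewrite mulrBl.
    by rewrite sumrB mulrBr opprD addrACA.
  move=> /asboolP[v [w [Vv Vw ->]]] /asboolP[v' [w' [Vv' Vw' ->]]].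
  apply/asboolP; exists (v * v').
  (* The default 0 keeps the coefficients in [V] at indices outside ['I_m], where [Vtc] says
     nothing. *)
  pose d i j k := if insub k is Some k' then t * c (e i * e j) (k' : 'I_m) else 0.
  exists (fun k => v * w' k + v' * w k +
    \sum_(i < m) \sum_(j < m) w i * w' j * d i j k); split.
  - exact: VM.
  - move=> k; apply: (VD); first by apply: (VD); apply: (VM).
    apply: (Vsum) => i; apply: (Vsum) => j; apply: (VM); first exact: (VM).
    by rewrite /d; case: insubP.
  set E := \sum_(i < m) w i * e i; set E' := \sum_(i < m) w' i * e i.
  have EE' : t * (E * E') = \sum_(k < m)
      (\sum_(i < m) \sum_(j < m) w i * w' j * d i j k) * e k.
    under [RHS]eq_bigr => k _ do rewrite mulr_suml.
    rewrite exchange_big mulr_suml mulr_sumr; apply: eq_bigr => i _ /=.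
    under [RHS]eq_bigr => k _ do rewrite mulr_suml.
    rewrite exchange_big !mulr_sumr; apply: eq_bigr => j _ /=.
    rewrite -mulrA (mulrA (e i)) -(cV _ (Vw' j) (e i)) -!mulrA.
    rewrite [e i * e j in LHS]cE !mulr_sumr; apply: eq_bigr => k _.
    by rewrite /d valK !mulrA -(mulrA t) (cV _ Vt).
  under eq_bigr => k _ do rewrite !mulrDl.
  rewrite !big_split /= -EE'.
  under eq_bigr => k _ do rewrite -mulrA.
  rewrite -mulr_sumr -/E'.
  under eq_bigr => k _ do rewrite -mulrA.
  rewrite -mulr_sumr -/E.
  rewrite mulrDl !mulrDr -!addrA; congr (_ + _).
  rewrite !mulrA (cV _ Vt v); congr (_ + _).
  rewrite -(cV _ Vv') !mulrA (cV _ Vt v') -!mulrA; congr (_ + _).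
  by rewrite !mulrA -(mulrA t E t) -(cV _ Vt E) !mulrA.
have [ncR minS _] := minR.
have S_e (i : 'I_m) : t * e i \in S.
  rewrite inS; apply/asboolP; exists 0, (fun j => if j == i :> nat then 1 else 0).
  split=> // [j|]; first by case: ifP.
  rewrite add0r (bigD1 i)//= eqxx mul1r big1 ?addr0// => j ji.
  by rewrite (negPf (ji : val j != val i)) mul0r.
have tU := divR _ nzt.
have [allP|/existsNP[r nPr]] := pselect (forall r, P r); first exact: allP.
case: ncR => x y.
have SC : {in S &, forall x y : R, x * y = y * x}.
  by apply: minS; split=> //; exists r; rewrite inS; apply/asboolPn.
have eC (i j : 'I_m) : e i * e j = e j * e i.
  have := SC _ _ (S_e i) (S_e j).
  rewrite -!mulrA => /(mulrI tU); rewrite !mulrA -!(cV _ Vt) -!mulrA.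
  exact: (mulrI tU).
rewrite (cE x) (cE y) mulr_suml.
rewrite mulr_sumr; apply: eq_bigr => i _.
rewrite mulr_suml mulr_sumr; apply: eq_bigr => j _.
rewrite -!mulrA (mulrA (e i)) -(cc y j) -!mulrA (mulrA (e j)) -(cc x i) -!mulrA.
by rewrite eC !mulrA cc.
Qed.

(** * The centre as a field *)

Section Center.

Variable R : unitRingType.

Definition center_pred : {pred R} := [pred z | `[<central z>]].

Lemma centerP (z : R) : reflect (central z) (z \in center_pred).
Proof. exact: asboolP. Qed.

Lemma center_divring_closed : GRing.divring_closed center_pred.
Proof.
split=> [|x y /centerP cx /centerP cy|x y /centerP cx /centerP cy].
- by apply/centerP => z; rewrite mul1r mulr1.
- by apply/centerP => z; rewrite mulrBl mulrBr cx cy.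
- apply/centerP => z; apply/esym/commrM; first exact/esym/cx.
  by apply/commrV/esym/cy.
Qed.

(** The proof argument is part of the type so that the field structure depending on it can be
    attached. *)
Definition centerType of division_ring R := {z : R | z \in center_pred}.

Variable divR : division_ring R.
Notation K := (centerType divR).

HB.instance Definition _ := [isSub of K for @sval _ _].
HB.instance Definition _ := [Choice of K by <:].
HB.instance Definition _ :=
  GRing.SubChoice_isSubUnitRing.Build R center_pred K center_divring_closed.

Lemma center_mulC : commutative (@GRing.mul K).
Proof. by move=> x y; apply: val_inj; rewrite !rmorphM; apply/centerP/valP. Qed.

HB.instance Definition _ := GRing.PzRing_hasCommutativeMul.Build K center_mulC.

Lemma center_field : GRing.field_axiom K.
Proof.
by move=> x nzx; apply: divR; apply: contraNneq nzx => x0; apply/eqP/val_inj.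
Qed.

HB.instance Definition _ := GRing.ComUnitRing_isField.Build K center_field.

End Center.

(** * Integrality and adjunction for subrings of a field *)

Section Subring.

Variable K : fieldType.

(** Subrings of [K] are represented as images of morphisms, so that adjoining an element amounts to
    passing to [{poly A}]. *)
Definition in_image (A : comNzRingType) (f : {rmorphism A -> K}) (u : K) :=
  exists a, f a = u.

Definition eval_at (A : comNzRingType) (f : {rmorphism A -> K}) (u : K) :
    {rmorphism {poly A} -> K} :=
  horner_eval u \o map_poly f.

Lemma eval_atE (A : comNzRingType) (f : {rmorphism A -> K}) u
    (p : {poly A}) :
  eval_at f u p = (map_poly f p).[u].
Proof. by []. Qed.

Lemma eval_at_image (A : comNzRingType) (f : {rmorphism A -> K}) u a :
  in_image f a -> in_image (eval_at f u) a.
Proof. by case=> b <-; exists b%:P; rewrite eval_atE map_polyC hornerC. Qed.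

Lemma eval_at_id (A : comNzRingType) (f : {rmorphism A -> K}) u :
  in_image (eval_at f u) u.
Proof. by exists 'X; rewrite eval_atE map_polyX hornerX. Qed.

Lemma eval_at_sum (A : comNzRingType) (f : {rmorphism A -> K}) u
    (p : {poly A}) n :
  (size p <= n)%N -> eval_at f u p = \sum_(i < n) f p`_i * u ^+ i.
Proof.
move=> le_pn; rewrite eval_atE (@horner_coef_wide _ n).
  by apply: eq_bigr => i _; rewrite coef_map.
by apply: leq_trans le_pn; rewrite size_poly.
Qed.

(** Multiplying a monic equation of [y^-1] of degree [d.+1] by [y ^+ d] expresses [y^-1] as a
    polynomial in [y]. *)
Lemma integral_inverse_image (A : comNzRingType) (f : {rmorphism A -> K}) y :
  in_image f y -> y != 0 -> integralOver f y^-1 -> in_image f y^-1.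
Proof.
move=> [a fa] nzy [p mon_p /rootP]; rewrite -eval_atE (eval_at_sum _ _ (leqnn _)).
move: (monicP mon_p); rewrite lead_coefE.
case: (size p) (polySpred (monic_neq0 mon_p)) => // d _ /= pd1.
rewrite big_ord_recr /= pd1 rmorph1 mul1r => root_y.
case: d => [|d] in pd1 root_y *.
  by move/eqP: root_y; rewrite big_ord0 add0r oner_eq0.
exists (- \sum_(i < d.+1) p`_i * a ^+ (d - i)).
rewrite rmorphN rmorph_sum; apply/eqP; rewrite eq_sym -addr_eq0; apply/eqP.
have := congr1 (fun z => z * y ^+ d) root_y.
rewrite mul0r mulrDl addrC => root_yd; rewrite -[RHS]root_yd; congr (_ + _).
  by rewrite exprS -mulrA exprVn mulVf ?mulr1// expf_neq0.
rewrite mulr_suml; apply: eq_bigr => i _.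
rewrite rmorphM rmorphXn /= fa -mulrA; congr (_ * _).
have le_id : (i <= d)%N by rewrite -ltnS.
rewrite -[X in _ = _ * y ^+ X](subnK le_id) exprD mulrCA exprVn.
by rewrite mulVf ?mulr1// expf_neq0.
Qed.

(** If [p] has degree [d.+1] and leading coefficient [c], then [c ^+ d] times the equation of [u] is
    a monic equation of [c * u]. *)
Lemma integral_leading (A : comNzRingType) (f : {rmorphism A -> K}) (u : K)
    (p : {poly K}) :
  (forall i, in_image f p`_i) -> root p u -> integralOver f (lead_coef p * u).
Proof.
move=> fp pu0; set c := lead_coef p.
have fM v w : in_image f v -> in_image f w -> in_image f (v * w).
  by move=> [v' <-] [w' <-]; exists (v' * w'); rewrite rmorphM.
have fX v k : in_image f v -> in_image f (v ^+ k).
  by move=> [v' <-]; exists (v' ^+ k); rewrite rmorphXn.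
have [->|nzc] := eqVneq c 0; first by rewrite mul0r; apply: integral0.
have [d szp] : exists d, size p = d.+1.
  by exists (size p).-1; rewrite prednK// lt0n size_poly_eq0 -lead_coef_eq0.
have cE : c = p`_d by rewrite /c lead_coefE szp.
case: d => [|d] in szp cE.
  move: pu0; rewrite rootE horner_coef szp big_ord_recr big_ord0 /= add0r mulr1.
  by rewrite -cE (negPf nzc).
pose r := \poly_(i < d.+1) (p`_i * c ^+ (d - i)).
apply: (@integral_root_monic _ _ _ _ ('X^(d.+1) + r)).
- by rewrite monicE lead_coefDl ?lead_coefXn// size_polyXn ltnS size_poly.
- rewrite rootE hornerD hornerXn (horner_coef_wide _ (size_poly _ _)).
  have := congr1 (fun z => c ^+ d * z) (rootP pu0).
  rewrite mulr0 horner_coef szp big_ord_recr /= -cE mulrDr addrC => pu.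
  apply/eqP; rewrite -[RHS]pu; congr (_ + _); first by rewrite exprMn mulrA -exprSr.
  rewrite mulr_sumr; apply: eq_bigr => i _; rewrite coef_poly ltn_ord.
  have le_id : (i <= d)%N by rewrite -ltnS.
  by rewrite exprMn !mulrA -(mulrA p`_i) -exprD subnK// (mulrC p`_i).
- apply/integral_poly => i.
  suff [a <-] : in_image f ('X^(d.+1) + r)`_i by apply: integral_id.
  rewrite coefD coefXn coef_poly.
  have fD v w : in_image f v -> in_image f w -> in_image f (v + w).
    by move=> [v' <-] [w' <-]; exists (v' + w'); rewrite rmorphD.
  apply: fD; first by exists (i == d.+1)%:R; rewrite rmorph_nat.
  case: ifP => _; last by exists 0; rewrite rmorph0.
  by apply/fM/fX; rewrite ?cE; apply: fp.
Qed.

(** Multiplying [u = q(u^-1)] by [u ^+ n] gives a monic equation whose lower coefficients are those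
    of [q] reversed, up to sign. *)
Lemma integral_of_inverse (A : comNzRingType) (f : {rmorphism A -> K}) u :
  in_image (eval_at f u^-1) u -> integralOver f u.
Proof.
move=> [q]; have [->|nzu] := eqVneq u 0; first by move=> _; apply: integral0.
rewrite (eval_at_sum _ _ (leqnn _)); case: (size q) => [|n] qu.
  by rewrite big_ord0 in qu; rewrite -qu eqxx in nzu.
pose r := \poly_(i < n.+1) q`_(n - i); exists ('X^(n.+1) - r).
  by rewrite monicE lead_coefDl ?lead_coefXn// size_polyN size_polyXn ltnS size_poly.
rewrite rootE -eval_atE rmorphB [eval_at _ _ 'X^_]eval_atE map_polyXn hornerXn.
rewrite subr_eq0 (eval_at_sum _ _ (size_poly _ _)) exprS -{1}qu mulr_suml.
rewrite (reindex_inj rev_ord_inj) /=; apply/eqP/eq_bigr => i _.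
have le_in : (i <= n)%N by rewrite -ltnS.
rewrite coef_poly ltn_ord subSS -mulrA; congr (_ * _).
rewrite -[X in _ * u ^+ X = _](subnK le_in) exprD mulrA exprVn.
by rewrite mulVf ?mul1r// expf_neq0.
Qed.

(* Adjoin [u] itself or, when that creates [y^-1], adjoin [b * u], with [b] the
   leading coefficient of an equation of [u]: [b * u] is integral, so if
   adjoining it created [y^-1], then [y^-1] would be integral, hence already in
   the image of [f]. *)
Lemma adjoin_avoiding (A : comNzRingType) (f : {rmorphism A -> K}) (y u : K) :
  in_image f y -> y != 0 -> ~ in_image f y^-1 ->
  exists (B : comNzRingType) (g : {rmorphism B -> K}) (b : K),
    [/\ forall z, in_image f z -> in_image g z, ~ in_image g y^-1, b != 0,
       in_image g b
      & in_image g (b * u)].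
Proof.
move=> fy nzy fVy.
have [[q qE]|nfu] := pselect (in_image (eval_at f u) y^-1); last first.
  exists {poly A}, (eval_at f u), 1; split; rewrite ?oner_eq0 ?mul1r//.
  - exact: eval_at_image.
  - by exists 1; rewrite rmorph1.
  - exact: eval_at_id.
(* The equation of [u] is [y^-1 = q(u)] multiplied by [y]. It is not trivial: its constant term
   would otherwise put [y^-1] in the image of [f]. *)
pose p := y *: map_poly f q - 1.
have fp i : in_image f p`_i.
  case: fy => a fa; exists (a * q`_i - (i == 0)%:R).
  by rewrite coefB coefZ coef_map coef1 rmorphB rmorphM rmorph_nat fa.
have pu0 : root p u.
  by rewrite rootE hornerD hornerZ -eval_atE qE hornerN hornerC mulfV ?subrr.
have nzp : p != 0.
  apply/eqP => /(congr1 (fun r : {poly K} => r`_0)); rewrite coefB coefZ coef_map.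
  rewrite coef1 coef0 => /subr0_eq yq; apply: fVy; exists q`_0.
  by rewrite -[LHS](mulKf nzy) yq mulr1.
have int_w := integral_leading fp pu0.
exists {poly A}, (eval_at f (lead_coef p * u)), (lead_coef p); split.
- exact: eval_at_image.
- move=> [r rE]; apply: fVy; apply: integral_inverse_image => //.
  rewrite -rE; apply: integral_horner => //; apply/integral_poly => i.
  by rewrite coef_map; apply: integral_id.
- by rewrite lead_coef_eq0.
- by apply: eval_at_image; rewrite lead_coefE.
- exact: eval_at_id.
Qed.

(** The multipliers found one after another persist in the later images, so their product is a
    common one. *)
Lemma adjoin_seq_avoiding (y : K) (s : seq K) (A : comNzRingType)
    (f : {rmorphism A -> K}) :
  in_image f y -> y != 0 -> ~ in_image f y^-1 ->
  exists (B : comNzRingType) (g : {rmorphism B -> K}) (b : K),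
    [/\ forall z, in_image f z -> in_image g z, ~ in_image g y^-1, b != 0,
       in_image g b
      & forall u, u \in s -> in_image g (b * u)].
Proof.
move=> + nzy; elim: s A f => [|u s IHs] A f fy fVy.
  exists A, f, 1; rewrite oner_eq0; split=> //.
  by exists 1; rewrite rmorph1.
have [B [g [b [fg gVy nzb gb gbu]]]] := adjoin_avoiding u fy nzy fVy.
have [C [h [c [gh hVy nzc hc hcs]]]] := IHs B g (fg _ fy) gVy.
have imM v w : in_image h v -> in_image h w -> in_image h (v * w).
  by move=> [v' <-] [w' <-]; exists (v' * w'); rewrite rmorphM.
exists C, h, (c * b); split=> //.
- by move=> z /fg/gh.
- exact: mulf_neq0.
- by apply: imM => //; apply: gh.
- move=> v; rewrite inE => /predU1P[->|/hcs hcv].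
    by rewrite -mulrA; apply: imM => //; apply: gh.
  by rewrite mulrAC; apply: imM => //; apply: gh.
Qed.

(** * Finite subrings of a field *)

Lemma finite_combinations (T : nzRingType) (s : seq T) (m : nat) (e : nat -> T) :
  exists s' : seq T, forall v : nat -> T, (forall i, v i \in s) ->
    \sum_(i < m) v i * e i \in s'.
Proof.
elim: m => [|m [s' s'P]]; first by exists [:: 0] => v _; rewrite big_ord0 inE.
exists [seq x + y * e m | x <- s', y <- s] => v vs; rewrite big_ord_recr /=.
by apply/allpairsP; exists (\sum_(i < m) v i * e i, v m); rewrite s'P ?vs.
Qed.

(** Modulo a monic equation of [u], every polynomial in [u] has bounded degree. *)
Lemma adjoin_finite (A : comNzRingType) (f : {rmorphism A -> K}) (u : K)
    (s : seq K) :
  (forall a, f a \in s) -> integralOver f u ->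
  exists s' : seq K, forall p, eval_at f u p \in s'.
Proof.
move=> fs [q mon_q qu0].
have [s' s'P] := finite_combinations s (size q) (fun i => u ^+ i).
exists s' => p; rewrite (Pdiv.RingMonic.rdivp_eq mon_q p) rmorphD rmorphM.
rewrite [eval_at f u q](rootP qu0) mulr0 add0r.
rewrite (@eval_at_sum _ _ _ _ (size q)).
  exact: (s'P (fun i => f (Pdiv.Ring.rmodp p q)`_i)).
by rewrite ltnW// Pdiv.Ring.ltn_rmodpN0 ?monic_neq0.
Qed.

Definition int_embedding : {rmorphism int -> K} := intmul 1.

Lemma adjoin_seq_finite (s : seq K) (A : comNzRingType) (f : {rmorphism A -> K}) :
  (forall u, integralOver int_embedding u) ->
  (exists s0 : seq K, forall a, f a \in s0) ->
  exists (B : comNzRingType) (g : {rmorphism B -> K}) (s' : seq K),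
    [/\ forall z, in_image f z -> in_image g z, forall b, g b \in s'
      & forall u, u \in s -> in_image g u].
Proof.
move=> intK; elim: s A f => [|u s IHs] A f [s0 fs0].
  by exists A, f, s0.
have [|B [g [s' [fg gs' gs]]]] := IHs _ (eval_at f u).
  apply: (adjoin_finite fs0); have [p mon_p pu0] := intK u.
  exists (map_poly intr p); first exact: monic_map.
  rewrite -map_poly_comp (eq_map_poly (g := int_embedding))// => z /=.
  by rewrite rmorph_int.
exists B, g, s'; split=> // [z /eval_at_image fz|v]; first exact/fg/fz.
by rewrite inE => /predU1P[->|/gs//]; apply/fg/eval_at_id.
Qed.

(** The hypothesis applied to [u^-1] makes [u] integral over the integers; applied to 2, it makes
    the characteristic positive. Adjunction then starts from a finite prime ring. *)
Lemma inverses_adjoin_finite (s : seq K) :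
  (forall y : K, y != 0 -> in_image (eval_at int_embedding y) y^-1) ->
  exists (B : comNzRingType) (g : {rmorphism B -> K}) (s' : seq K),
    (forall b, g b \in s') /\ (forall u, u \in s -> in_image g u).
Proof.
move=> invK.
have intK u : integralOver int_embedding u.
  have [->|nzu] := eqVneq u 0; first exact: integral0.
  by apply: integral_of_inverse; rewrite -{2}[u]invrK; apply/invK; rewrite invr_eq0.
have [k nzk k0] : exists2 k : int, k != 0 & k%:~R = 0 :> K.
  have [two0|nz2] := eqVneq (2%:R : K) 0; first by exists 2.
  have [q qE] := invK _ nz2.
  have q2E : int_embedding q.[2] = 2^-1 by rewrite -qE eval_atE -horner_map rmorph_nat.
  (* This integer is odd, hence nonzero, and vanishes in [K] because [q.[2]] maps to the inverse of
     2. *)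
  exists (2 * q.[2] - 1).
    rewrite subr_eq0; apply/eqP => q2.
    by have := dvdz_mulr q.[2] (dvdzz 2); rewrite q2.
  change (int_embedding (2 * q.[2] - 1) = 0).
  by rewrite rmorphB rmorphM rmorph1 rmorph_nat q2E mulfV ?subrr.
have [|B [g [s' [_ gs' gs]]]] := @adjoin_seq_finite s int int_embedding intK.
  exists [seq j%:R | j <- iota 0 `|k|] => a.
  have mod_ge0 := modz_ge0 a nzk.
  apply/mapP; exists `|(a %% k)%Z|%N.
    by rewrite mem_iota add0n -ltz_nat gez0_abs// ltz_mod.
  rewrite [a in LHS](divz_eq a k) rmorphD rmorphM /= k0 mulr0 add0r.
  by rewrite -{1}(gez0_abs mod_ge0).
by exists B, g, s'.
Qed.

End Subring.

(** * Wedderburn's theorem and the conclusion *)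

Lemma finite_division_ring_commutative (R : unitRingType) (s : seq R) :
  division_ring R -> (forall x, x \in s) -> commutative_ring R.
Proof.
move=> divR s_all.
have indexK : cancel (index^~ s) (nth 0 s) by move=> x; apply: nth_index.
pose cR := CanIsCountable indexK.
have enumR : Finite.axiom (undup s).
  by move=> x; rewrite count_uniq_mem ?undup_uniq// mem_undup s_all.
pose fR := isFinite.Build R enumR.
pose finR : finUnitRingType := HB.pack (GRing.UnitRing.sort R) cR fR.
apply: (@finDomain_mulrC finR) => x y xy0.
have [//|nzx] := eqVneq x 0; apply/eqP.
by apply: (mulrI (divR x nzx)); rewrite mulr0.
Qed.

Theorem proposition5p14 (R : unitRingType)
    (divR : division_ring R) (minR : minimal_noncommutative R)
    (x : R) (ncx : ~ central x) :
  ~ algebraic_over_center x.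
Proof.
move=> algx; have [N depN] := finite_over_center divR minR ncx algx.
(* Extending the family consisting of 1 alone gives a basis with [e 0 = 1], needed to compare
   coordinates of central elements. *)
have free1 : left_free (commutant (fun=> True)) 1 (fun=> 1 : R).
  by move=> a _; rewrite big_ord_recr big_ord0 /= add0r mulr1 => a0 [].
have [[|m] [e [// _ e0 fr_e sp_e]]] := extend_basis divR depN free1.
have {}e0 : e 0%N = 1 by rewrite e0.
have /choice[c cP] : forall s, exists a : nat -> R,
    (forall i, central (a i)) /\ s = \sum_(i < m.+1) a i * e i.
  by move=> s; have [a ca ->] := sp_e s; exists a; split=> // i; apply/centralP.
have cc s i : central (c s i) by have [] := cP s.
have cE s : s = \sum_(i < m.+1) c s i * e i by have [] := cP s.
pose K := centerType divR.
pose cK s i : K := Sub (c s i) (introT (centerP _) (cc s i)).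
pose cs := [seq cK (e ijk.1 * e ijk.2.1) ijk.2.2 |
    ijk : 'I_m.+1 * ('I_m.+1 * 'I_m.+1)].
have csP (i j k : 'I_m.+1) : cK (e i * e j) k \in cs.
  by apply/mapP; exists (i, (j, k)); rewrite // mem_enum.
pose V (B : comNzRingType) (g : {rmorphism B -> K}) r := exists b, r = val (g b).
have fullV (B : comNzRingType) (g : {rmorphism B -> K}) (b : K) :
    b != 0 -> in_image g b -> (forall u, u \in cs -> in_image g (b * u)) ->
    forall r, exists v (w : nat -> R), [/\ V B g v, forall i, V B g (w i) &
      r = v + val b * \sum_(i < m.+1) w i * e i].
  move=> nzb gb gbcs.
  apply: (order_full divR minR cc cE) => //.
  - by move=> _ [a ->]; apply/centerP/valP.
  - by exists 1; rewrite !rmorph1.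
  - by move=> _ _ [a ->] [a' ->]; exists (a - a'); rewrite !rmorphB.
  - by move=> _ _ [a ->] [a' ->]; exists (a * a'); rewrite !rmorphM.
  - by case: gb => a <-; exists a.
  - by move=> i j k; have [a aE] := gbcs _ (csP i j k); exists a; rewrite aE.
have [invK|/existsNP[y /not_implyP[nzy nVy]]] :=
    pselect (forall y : K, y != 0 -> in_image (eval_at (int_embedding K) y) y^-1).
  have [B [g [s [gs gcs]]]] := inverses_adjoin_finite cs invK.
  (* With [t = 1], every element of [R] is a sum of an element of the finite image of [g] and a
     combination of the [e i] over it. *)
  have [s' s'P] := finite_combinations (map val s) m.+1 e.
  have [ncR _ _] := minR; apply: ncR.
  pose sR := [seq v + w | v <- map val s, w <- s'].
  apply: (@finite_division_ring_commutative _ sR) => // r.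
  have [||u /gcs|v [w [[a ->] Vw ->]]] := fullV B g 1 _ _ _ r.
  - exact: oner_neq0.
  - by exists 1; rewrite rmorph1.
  - by rewrite mul1r.
  rewrite rmorph1 mul1r; apply/allpairsP.
  exists (val (g a), \sum_(i < m.+1) w i * e i); split=> //=; first exact: map_f.
  by apply: s'P => i; have [a' ->] := Vw i; apply: map_f.
have [B [g [b [_ gVy nzb gb gbcs]]]] :=
  adjoin_seq_avoiding cs (eval_at_id _ _) nzy nVy.
(* Comparing the coordinates along [e 0 = 1] in this expression of [y^-1] gives
   [y^-1 = g a + b * w 0], an element of the image of [g]. *)
have [v [w [[a ->] Vw yE]]] := fullV B g b nzb gb gbcs (val y^-1).
case: gb => b' b'E; have [a0 w0E] := Vw 0%N; apply: gVy; exists (a + b' * a0).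
apply: val_inj; rewrite rmorphD rmorphM b'E rmorphD rmorphM /= -w0E.
set z := val y^-1 in yE *.
pose d i := val b * w i + (if i == 0%N then val (g a) - z else 0).
have cd i : commutant (fun=> True) (d i).
  suff [k ->] : exists k : K, d i = val k by apply/centralP/centerP/valP.
  rewrite /d; have [a' ->] := Vw i; case: ifP => _.
    by exists (b * g a' + (g a - y^-1)); rewrite rmorphD rmorphM rmorphB.
  by exists (b * g a'); rewrite addr0 rmorphM.
have sum_d : \sum_(i < m.+1) d i * e i = 0.
  under eq_bigr => i _ do rewrite mulrDl -mulrA.
  rewrite big_split -mulr_sumr /= [X in _ + X]big_ord_recl /= e0 mulr1.
  rewrite [X in _ + (_ + X)]big1 => [|i _]; last by rewrite mul0r.
  by rewrite addr0 yE opprD [X in _ + X]addrA subrr add0r subrr.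
have := fr_e d cd sum_d 0%N isT.
rewrite /d eqxx addrA => /subr0_eq d0; rewrite addrC; apply: d0.
Qed.
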